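(* For integers $A,B\ge0$ put $J_{A,B}(t)=\sum_{k\ge0}\binom{A}{k}\binom{B}{k}t^k$. Fix an integer $\kappa\ge0$, and for $n\ge1$ write $J_{n,n+\kappa}(t)=\prod_{j=1}^{n}(t-\zeta_{n,\kappa,j})$ up to its positive leading factor, with $\zeta_{n,\kappa,1}<\cdots<\zeta_{n,\kappa,n}<0$ (so $J_{n,n+\kappa}$ has $n$ distinct negative real zeros). Then for every $n\ge1$ the zeros of $J_{n,n+\kappa}$ and $J_{n+1,n+1+\kappa}$ strictly interlace on $(-\infty,0)$: $$\zeta_{n+1,\kappa,1}<\zeta_{n,\kappa,1}<\zeta_{n+1,\kappa,2}<\cdots<\zeta_{n,\kappa,n}<\zeta_{n+1,\kappa,n+1}.$$ *)

(* Defs.v *)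
From HB Require Import structures.
From mathcomp Require Import all_boot all_order all_algebra.
From mathcomp Require Import reals.

Set Implicit Arguments.
Unset Strict Implicit.
Unset Printing Implicit Defensive.

Import Order.TTheory GRing.Theory Num.Theory.
Local Open Scope ring_scope.

(* The series over all k >= 0 stops at k = A, since 'C(A, k) = 0 for k > A. *)
Definition J (R : realType) (A B : nat) : {poly R} :=
  \sum_(k < A.+1) ('C(A, k) * 'C(B, k))%N%:R *: 'X^k.

(* The zeros are indexed from 0: z j stands for zeta_{j+1}. *)
Definition ordered_negative_zeros (R : realType) (n : nat)
    (p : {poly R}) (z : 'I_n -> R) : Prop :=
  [/\ exists2 c : R, 0 < c & p = c *: \prod_(j < n) ('X - (z j)%:P),
      forall i j : 'I_n, (i < j)%N -> z i < z j
    & forall j : 'I_n, z j < 0].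

(* lift ord0 j is the index j + 1 in 'I_n.+1. *)
Definition strictly_interlace (R : realType) (n : nat)
    (z : 'I_n -> R) (z' : 'I_n.+1 -> R) : Prop :=
  forall j : 'I_n, z' (widen_ord (leqnSn n) j) < z j < z' (lift ord0 j).

(* Main.v *)
Require Import Defs.
From HB Require Import structures.
From mathcomp Require Import all_boot all_order all_algebra.
From mathcomp Require Import reals.
From mathcomp Require Import polyrcf ring lra.

Set Implicit Arguments.
Unset Strict Implicit.
Unset Printing Implicit Defensive.

Import Order.TTheory GRing.Theory Num.Theory.
Local Open Scope ring_scope.

(* With N = n + 1 and M = n + kappa + 1, comparing coefficients gives
     N M J_{N,M} = (N M + b t) J_{N-1,M-1} + (N + M) t (1 - t) J_{N-1,M-1}'
   for a constant b. At a zero of J_{N-1,M-1}, which is negative, J_{N,M}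
   therefore has the sign opposite to J_{N-1,M-1}'. That derivative alternates
   in sign along the simple zeros; together with the signs of J_{N,M} at
   -infinity and at 0, the intermediate value theorem gives one zero of J_{N,M}
   in each of the N gaps, and the degree leaves room for no other. Existence
   follows by induction on n, starting from J_{0,kappa} = 1. *)

Lemma sorted_codom (R : realType) n (w : 'I_n -> R) :
  (forall i j : 'I_n, (i < j)%N -> w i < w j) -> sorted <%R (codom w).
Proof.
move=> w_incr; rewrite sorted_map.
apply: (@sub_sorted _ (relpre val ltn)); first by move=> i j; exact: w_incr.
by rewrite -sorted_map val_enum_ord iota_ltn_sorted.
Qed.

Lemma ordered_negative_zeros_root (R : realType) n (p : {poly R})
    (z : 'I_n -> R) x :
  ordered_negative_zeros p z -> root p x = (x \in codom z).
Proof.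
case=> -[c c0 ->] _ _; rewrite rootZ ?gt_eqF //.
have -> : \prod_(j < n) ('X - (z j)%:P) = \prod_(y <- codom z) ('X - y%:P).
  by rewrite big_map big_enum.
by rewrite root_prod_XsubC.
Qed.

(** Both families are strictly increasing enumerations of the same root set. This carries
    interlacing over from constructed zeros to given ones. *)
Lemma ordered_negative_zeros_unique (R : realType) n (p : {poly R})
    (z w : 'I_n -> R) :
  ordered_negative_zeros p z -> ordered_negative_zeros p w -> z =1 w.
Proof.
move=> pz pw; have [_ z_incr _] := pz; have [_ w_incr _] := pw.
have eq_zw : codom z = codom w.
  apply: lt_sorted_eq; [exact: sorted_codom..|] => x.
  by rewrite -(ordered_negative_zeros_root x pz) (ordered_negative_zeros_root x pw).
by move=> i; apply: ((eq_in_map _ _ _).2 eq_zw); rewrite mem_enum.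
Qed.

Lemma ordered_negative_zerosI (R : realType) n (q : {poly R}) (w : 'I_n -> R) :
  size q = n.+1 -> 0 < lead_coef q ->
  (forall i j : 'I_n, (i < j)%N -> w i < w j) ->
  (forall j, w j < 0) -> (forall j, root q (w j)) ->
  ordered_negative_zeros q w.
Proof.
move=> size_q lead_q w_incr w_neg qw; split=> //; exists (lead_coef q) => //.
rewrite {1}(@all_roots_prod_XsubC _ q (codom w)).
- by rewrite big_map big_enum.
- by rewrite size_codom card_ord.
- by apply/allP => _ /codomP[j ->].
- by rewrite uniq_rootsE lt_sorted_uniq // sorted_codom.
Qed.

(** By the product rule only the product of the [z i - z j] with [j != i] survives at [z i], and its
    negative factors are the [n - i.+1] ones with [j > i]. *)
Lemma sgr_deriv_at_zero (R : realType) n (p : {poly R}) (z : 'I_n -> R) i :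
  ordered_negative_zeros p z -> Num.sg p^`().[z i] = (-1) ^+ (n - i.+1).
Proof.
case=> -[c c0 ->] z_incr _.
rewrite (bigD1 i) //= derivZ derivM derivXsubC mul1r.
rewrite hornerZ hornerD hornerM hornerXsubC subrr mul0r addr0 horner_prod.
rewrite sgrM gtr0_sg // mul1r (big_morph Num.sg (@sgrM R) (sgr1 R)).
have -> : (-1) ^+ (n - i.+1) = \prod_(j < n | (i < j)%N) (-1 : R).
  by rewrite -prodr_const_nat big_geq_mkord.
rewrite [LHS]big_mkcond [RHS]big_mkcond; apply: eq_bigr => j _.
rewrite hornerXsubC; case: (ltngtP i j) => [ij|ji|/val_inj ->].
- by rewrite -(inj_eq val_inj) gtn_eqF // ltr0_sg // subr_lt0 z_incr.
- by rewrite -(inj_eq val_inj) ltn_eqF // gtr0_sg // subr_gt0 z_incr.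
- by rewrite eqxx.
Qed.

Lemma interlacing_zeros (R : realType) n (p q : {poly R}) (z : 'I_n -> R) :
  ordered_negative_zeros p z ->
  size q = n.+2 -> 0 < lead_coef q -> 0 < q.[0] ->
  (forall j, Num.sg q.[z j] = - Num.sg p^`().[z j]) ->
  exists2 w : 'I_n.+1 -> R,
    ordered_negative_zeros q w & strictly_interlace z w.
Proof.
move=> pz size_q lead_q q0 qz; have [_ z_incr z_neg] := pz.
(* Indices past the last zero give 0, which then serves as the right end. *)
pose zs k := oapp z 0 (insub k).
have zsE (j : 'I_n) : zs j = z j by rewrite /zs valK.
have zsN k : (n <= k)%N -> zs k = 0 by move=> nk; rewrite /zs insubN // -leqNgt.
have zs_le0 k : zs k <= 0.
  by rewrite /zs; case: insubP => //= j _ _; exact/ltW.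
have zs_lt k l : (k < l)%N -> (k < n)%N -> zs k < zs l.
  move=> kl kn; rewrite -[k]/(val (Ordinal kn)) zsE.
  have [ln|nl] := ltnP l n; last by rewrite zsN.
  by rewrite -[l]/(val (Ordinal ln)) zsE z_incr.
have zs_le k l : (k <= l)%N -> zs k <= zs l.
  rewrite leq_eqVlt => /predU1P[->//|kl].
  have [kn|nk] := ltnP k n; first exact/ltW/zs_lt.
  by rewrite !zsN // (leq_trans nk) // ltnW.
(* y lists the n + 2 nodes at which q alternates in sign: a point below all
   roots of q and p, then the zeros of p, then 0. *)
pose x0 := Num.min (- cauchy_bound q) (zs 0%N - 1).
pose y k : R := if k is k'.+1 then zs k' else x0.
have sg_y k : (k <= n.+1)%N -> Num.sg q.[y k] = (-1) ^+ (n.+1 - k).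
  case: k => [_|k kn].
    rewrite subn0 /y (@sgp_minftyP _ (- cauchy_bound q)).
    - by rewrite /sgp_minfty size_q sgrM sgrX sgrN1 gtr0_sg ?mulr1.
    - by apply: le_cauchy_bound; rewrite -size_poly_gt0 size_q.
    - by rewrite in_itv /= ge_min lexx.
  (* The last node is 0, where [q] is positive. At a zero of [p] the opposite sign of [q] supplies
     the extra factor -1 that turns [n - k.+1] into [n - k]. *)
  rewrite /y subSS; move: kn; rewrite ltnS leq_eqVlt => /predU1P[->|kn].
    by rewrite zsN // subnn gtr0_sg.
  rewrite -[k]/(val (Ordinal kn)) zsE qz (sgr_deriv_at_zero _ pz) /=.
  by rewrite -[(n - k)%N](@prednK) ?subn_gt0 // -subnS exprS mulN1r.
have y_lt k : (k <= n)%N -> y k < y k.+1.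
  case: k => [_|k kn]; last exact: zs_lt.
  by rewrite /= gt_min; apply/orP; right; lra.
have zero_in (i : 'I_n.+1) : {x | x \in `]y i, y i.+1[ & root q x}.
  have i_n : (i <= n)%N by rewrite -ltnS.
  apply: poly_ivtoo; first exact/ltW/y_lt.
  rewrite -sgr_lt0 sgrM (sg_y i (leqW i_n)) (sg_y i.+1 i_n).
  rewrite subSS subSn // exprS mulN1r mulNr.
  by rewrite -expr2 sqrr_sign; lra.
pose w i : R := s2val (zero_in i).
have w_itv (i : 'I_n.+1) : y i < w i < y i.+1.
  by have := s2valP (zero_in i); rewrite in_itv.
have w_incr (i j : 'I_n.+1) : (i < j)%N -> w i < w j.
  (* The gaps do not overlap: [w i < y i.+1 <= y j < w j]. *)
  move=> ij; have /andP[_ wi] := w_itv i; have /andP[wj _] := w_itv j.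
  apply: (lt_le_trans wi); apply: le_trans (ltW wj).
  by case: (val j) ij => // k ik; exact: zs_le.
exists w.
  apply: ordered_negative_zerosI => // j; last exact: s2valP' (zero_in j).
  by have /andP[_ /lt_le_trans] := w_itv j; apply; exact: zs_le0.
(* The node [y j.+1], which is [z j], is the right end of gap [j] and the left end of gap [j.+1]. *)
move=> j; have /andP[_] := w_itv (widen_ord (leqnSn n) j).
have /andP[+ _] := w_itv (lift ord0 j).
by rewrite /= /bump /= zsE => -> ->.
Qed.

Lemma coefJ (R : realType) A B k :
  (J R A B)`_k = 'C(A, k)%:R * 'C(B, k)%:R.
Proof.
rewrite /J coef_sum -natrM.
under eq_bigr do rewrite coefZ coefXn.
have [kA|Ak] := leqP k A.
  rewrite (bigD1 (Ordinal (kA : (k < A.+1)%N))) //= eqxx mulr1 big1 ?addr0 //.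
  by move=> i; rewrite -(inj_eq val_inj) eq_sym => /negPf /= ->; rewrite mulr0.
rewrite bin_small // big1 // => i _.
by rewrite gtn_eqF ?mulr0 // (leq_ltn_trans _ Ak) // -ltnS.
Qed.

Lemma size_J (R : realType) n m : (n <= m)%N -> size (J R n m) = n.+1.
Proof.
move=> nm; apply/eqP; rewrite eqn_leq; apply/andP; split.
  by apply/leq_sizeP => k nk; rewrite coefJ bin_small // mul0r.
rewrite ltnNge; apply/negP => /leq_sizeP/(_ n (leqnn _))/eqP.
by rewrite coefJ binn mul1r pnatr_eq0 -leqn0 leqNgt bin_gt0 nm.
Qed.

(* Contiguous relation for Jacobi polynomials: J_{n,m}(t) is (1-t)^n times the
   Jacobi polynomial P_n^{(0,m-n)} at (1+t)/(1-t) when n <= m. *)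
Lemma J_recurrence (R : realType) n m :
  let N : R := n.+1%:R in let M : R := m.+1%:R in
  (N * M) *: J R n.+1 m.+1 =
    ((N * M)%:P + ((N + M) * (N + M - 1) - N * M) *: 'X) * J R n m
    + (N + M) *: ('X * ((1 - 'X) * (J R n m)^`())).
Proof.
move=> N M; apply/polyP => k.
have binl a i : (a.+1%:R - i%:R) * 'C(a.+1, i)%:R = a.+1%:R * 'C(a, i)%:R :> R.
  have [ia|ai] := leqP i a.+1.
    by rewrite -natrB // -!natrM mul_bin_down.
  by rewrite !bin_small ?mulr0 // ltnW.
have bind a i : i.+1%:R * 'C(a.+1, i.+1)%:R = a.+1%:R * 'C(a, i)%:R :> R.
  by rewrite -!natrM mul_bin_diag.
have N0 : N != 0 by rewrite pnatr_eq0.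
have M0 : M != 0 by rewrite pnatr_eq0.
set p := J R n m.
have coefXd i : ('X * p^`())`_i = i%:R * p`_i.
  by case: i => [|i]; rewrite coefXM ?mul0r // coef_deriv mulr_natl.
(* Expanded this way, each term has a coefficient that is a multiple of [p] at index [k] or
   [k - 1]. *)
have -> : ((N * M)%:P + ((N + M) * (N + M - 1) - N * M) *: 'X) * p
      + (N + M) *: ('X * ((1 - 'X) * p^`()))
    = (N * M) *: p + ((N + M) * (N + M - 1) - N * M) *: ('X * p)
      + (N + M) *: ('X * p^`() - 'X * ('X * p^`())).
  by rewrite -!mul_polyC; ring.
rewrite !(coefD, coefB, coefN, coefZ) coefXd (coefXM p) (coefXM ('X * _)).
case: k => [|k]; rewrite /= ?coefXd !coefJ ?bin0; first by ring.
have eN := binl n k.+1; have eM := binl m k.+1.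
have fN := bind n k; have fM := bind m k.
rewrite -/N in eN fN; rewrite -/M in eM fM.
(* Absorption makes every term a multiple of ['C(n.+1, k.+1) * 'C(m.+1, k.+1)], which leaves a
   rational identity in [N], [M] and [k]. *)
have -> : 'C(n, k.+1)%:R = (N - k.+1%:R) * 'C(n.+1, k.+1)%:R / N :> R.
  by rewrite eN mulrC mulKf.
have -> : 'C(m, k.+1)%:R = (M - k.+1%:R) * 'C(m.+1, k.+1)%:R / M :> R.
  by rewrite eM mulrC mulKf.
have -> : 'C(n, k)%:R = k.+1%:R * 'C(n.+1, k.+1)%:R / N :> R.
  by rewrite fN mulrC mulKf.
have -> : 'C(m, k)%:R = k.+1%:R * 'C(m.+1, k.+1)%:R / M :> R.
  by rewrite fM mulrC mulKf.
rewrite -[k.+1%:R]natr1; field.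
by rewrite !nat1r !pnatr_eq0.
Qed.

Lemma J_interlacing_step (R : realType) n kappa (z : 'I_n -> R) :
  ordered_negative_zeros (J R n (n + kappa)) z ->
  exists2 w : 'I_n.+1 -> R,
    ordered_negative_zeros (J R n.+1 (n.+1 + kappa)) w & strictly_interlace z w.
Proof.
move=> Jz; have [_ _ z_neg] := Jz.
have size_J1 : size (J R n.+1 (n.+1 + kappa)) = n.+2.
  by rewrite size_J // leq_addr.
apply: (interlacing_zeros Jz) => // [||j].
- by rewrite lead_coefE size_J1 coefJ binn mul1r ltr0n bin_gt0 leq_addr.
- by rewrite horner_coef0 coefJ !bin0 mulr1.
have /eqP : root (J R n (n + kappa)) (z j).
  by rewrite (ordered_negative_zeros_root _ Jz) codom_f.
move=> Jzj0.
(* At [z j] only the derivative term survives, and its factor [(N + M) * z j * (1 - z j)] is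
   negative. *)
have := congr1 (fun p => Num.sg p.[z j]) (J_recurrence R n (n + kappa)).
rewrite /= hornerZ hornerD hornerM Jzj0 mulr0 add0r !(hornerE, hornerM).
rewrite !sgrM !(gtr0_sg (ltr0Sn _ _)) !mul1r -addSn => ->.
have z1 : 0 < 1 - z j by rewrite subr_gt0 (lt_trans (z_neg j)).
have NM : 0 < n.+1%:R + (n.+1 + kappa)%:R :> R by rewrite addr_gt0.
by rewrite (ltr0_sg (z_neg j)) (gtr0_sg z1) (gtr0_sg NM) !mul1r !mulN1r.
Qed.

Theorem corollary4p11 (R : realType) (kappa : nat) :
  (forall n : nat, (1 <= n)%N ->
     exists z : 'I_n -> R, ordered_negative_zeros (J R n (n + kappa)) z) /\
  (forall (n : nat) (z : 'I_n -> R) (z' : 'I_n.+1 -> R), (1 <= n)%N ->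
     ordered_negative_zeros (J R n (n + kappa)) z ->
     ordered_negative_zeros (J R n.+1 (n.+1 + kappa)) z' ->
     strictly_interlace z z').
Proof.
split=> [n _|n z z' _ Jz Jz'].
  elim: n => [|n [z /J_interlacing_step[w Jw _]]]; last by exists w.
  (* The induction starts below the stated range, at the constant 1 with the empty family of
     zeros. *)
  exists (fun=> 0); split=> [|[]//|[]//]; exists 1 => //.
  by rewrite /J big_ord1 big_ord0 !bin0 expr0.
have [w Jw zw] := J_interlacing_step Jz.
by move=> j; rewrite !(ordered_negative_zeros_unique Jz' Jw).
Qed.
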